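(* Let $A=\{x_k\}_{k\in\mathbb{N}}$ and $B=\{y_k\}_{k\in\mathbb{N}}$ be two decreasing sequences of positive real numbers tending to $0$, with initial points $x_0$ and $y_0$, such that $x_k-x_{k+1}\simeq x_k^{\alpha}$ for some $\alpha>1$ and $y_k-y_{k+1}\simeq y_k^{\beta}$ for some $\beta>1$. Let $S(x_0,y_0)=\{(x_k,y_k)\}$ be the two-dimensional discrete dynamical system (orbit) with initial point $(x_0,y_0)$. Then: (i) if $\alpha\ge\beta$, then $\dim_BS=1-\frac1\alpha$; (ii) if $\alpha<\beta$, then $\dim_BS=1-\frac1\beta$.
   Context: For sequences of positive reals, $a_k\simeq b_k$ means that there are constants $c_1,c_2>0$ with $c_1\le a_k/b_k\le c_2$ for all sufficiently large $k$. Box dimension: for bounded $A\subset\mathbb{R}^N$ let $A_\varepsilon$ be its $\varepsilon$-neighborhood and $|A_\varepsilon|$ its Lebesgue measure. For $s\ge0$ put $\mathcal M_*^s(A)=\liminf_{\varepsilon\to0}|A_\varepsilon|/\varepsilon^{N-s}$ and $\mathcal M^{*s}(A)=\limsup_{\varepsilon\to0}|A_\varepsilon|/\varepsilon^{N-s}$. The lower and upper box dimensions are $\inf\{s>0:\mathcal M_*^s(A)=0\}$ and $\inf\{s>0:\mathcal M^{*s}(A)=0\}$; if equal, the common value is $\dim_BA$. *)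

(* Defs.v *)
From mathcomp Require Import all_boot all_order all_algebra.
From mathcomp Require Import all_classical all_reals all_analysis.
Set Implicit Arguments.
Unset Strict Implicit.
Unset Printing Implicit Defensive.
Import Order.TTheory GRing.Theory Num.Theory.
Import numFieldNormedType.Exports.
Local Open Scope classical_set_scope.
Local Open Scope ring_scope.

(* Meant for sequences of positive reals. *)
Definition asymp_equiv (R : realType) (a b : nat -> R) : Prop :=
  exists c1 c2 : R,
    [/\ 0 < c1, 0 < c2 & \forall k \near \oo, c1 <= a k / b k <= c2].

(* The canonical norm on R * R is the sup norm, hence an explicit Euclidean
   distance. *)
Definition edist (R : realType) (p q : R * R) : R :=
  Num.sqrt ((p.1 - q.1) ^+ 2 + (p.2 - q.2) ^+ 2).

Definition eps_nbhd (R : realType) (A : set (R * R)) (eps : R) : set (R * R) :=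
  [set p | exists2 q, A q & edist p q < eps].

Definition area (R : realType) : set (R * R) -> \bar R :=
  (@lebesgue_measure R \x @lebesgue_measure R)%E.

(* |A_eps| / eps ^ (N - s), for N = 2. *)
Definition minkowski_ratio (R : realType) (A : set (R * R)) (s eps : R) :
    \bar R :=
  (area (eps_nbhd A eps) * ((eps `^ (2 - s))^-1)%:E)%E.

Definition lower_minkowski (R : realType) (s : R) (A : set (R * R)) : \bar R :=
  limf_einf (minkowski_ratio A s) (0 : R)^'+.

Definition upper_minkowski (R : realType) (s : R) (A : set (R * R)) : \bar R :=
  limf_esup (minkowski_ratio A s) (0 : R)^'+.

(* The infimum is taken in \bar R because the infimum of the empty set in R
   is 0 by convention. *)
Definition lower_box_dim (R : realType) (A : set (R * R)) : \bar R :=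
  ereal_inf [set s%:E | s in [set s : R | 0 < s /\ lower_minkowski s A = 0%E]].

Definition upper_box_dim (R : realType) (A : set (R * R)) : \bar R :=
  ereal_inf [set s%:E | s in [set s : R | 0 < s /\ upper_minkowski s A = 0%E]].

Definition has_box_dim (R : realType) (A : set (R * R)) (d : R) : Prop :=
  lower_box_dim A = d%:E /\ upper_box_dim A = d%:E.

Definition orbit2 (R : realType) (x y : nat -> R) : set (R * R) :=
  range (fun k => (x k, y k)).

(* Main.v *)
Require Import Defs.
From mathcomp Require Import all_boot all_order all_algebra.
From mathcomp Require Import all_classical all_reals all_analysis.
From mathcomp Require Import measurable_realfun zify ring lra.
Import Order.TTheory GRing.Theory Num.Theory.
Import numFieldNormedType.Exports.
Local Open Scope classical_set_scope.
Local Open Scope ring_scope.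

(** By symmetry of the plane one may assume beta <= alpha, so that x decays
    no faster than y.  Everything follows from two-sided bounds, for small e,
<<
      c * e ^ (1 + 1 / alpha) <= |S_e| <= C * e ^ (1 + 1 / alpha),
>>
    because with d = 1 - 1 / alpha the exponent is 2 - d, so the Minkowski
    ratio of order s is comparable to e ^ (s - d) ([has_box_dim_area]).

    Both bounds split the orbit where its gaps become comparable to e, that is
    where x k is of order e ^ (1 / alpha).

    Upper bound ([area_orbit_decay]).  The step condition makes
    x k ^ (1 - alpha) grow at least linearly, by Bernoulli's inequality, hence
    x k = O(k ^ (- 1 / (alpha - 1))) ([step_decay]); the same holds for y with
    beta, so y decays at least as fast as x.  The first n ~ e ^ (- d) points of
    the orbit are covered one by one by squares of side of order e.  The
    remaining ones form a monotone chain in a box of side O(n ^ (- 1 / (alpha - 1)))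
    = O(e ^ (1 - d)).  On a monotone chain the function x + y controls both
    coordinates, so slicing its values into intervals of length e groups these
    points into O(e ^ (- d)) clusters of diameter O(e) ([chain_cover]).
    Altogether O(e ^ (- d)) squares of area O(e ^ 2).

    Lower bound ([area_orbit_step]).  Below x n ~ e ^ (1 / alpha) consecutive
    abscissas are at most e / 2 apart, so every vertical line at abscissa
    u in ]0, x n[ meets S_e in an interval of length at least e / 2; integrate
    over u. *)

(** * Limits superior and inferior along a proper filter *)

Section LimSupInf.
Context {T : choiceType} {X : filteredType T} {R : realType}.
Variables (f : X -> \bar R) (F : set_system X).
Context {FF : ProperFilter F}.

Lemma limf_esup_le (l : \bar R) :
  (\forall a \near F, (f a <= l)%E) -> (limf_esup f F <= l)%E.
Proof.
move=> fl; rewrite limf_esupE.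
apply: ge_ereal_inf; exists (ereal_sup (f @` [set a | (f a <= l)%E])).
  by exists [set a | (f a <= l)%E].
by apply: ge_ereal_sup => _ [a /= ? <-].
Qed.

Lemma limf_esup_ge (l : \bar R) :
  (\forall a \near F, (l <= f a)%E) -> (l <= limf_esup f F)%E.
Proof.
move=> lf; rewrite limf_esupE; apply: le_ereal_inf_tmp => _ [V FV <-].
have [a [Va lfa]] := filter_ex (filterI FV lf).
by apply: (le_trans lfa); apply: ereal_sup_ubound; exists a.
Qed.

End LimSupInf.

Lemma limf_einf_le {T : choiceType} {X : filteredType T} {R : realType}
    (f : X -> \bar R) (F : set_system X) {FF : ProperFilter F} (l : \bar R) :
  (\forall a \near F, (f a <= l)%E) -> (limf_einf f F <= l)%E.
Proof.
move=> fl; rewrite /limf_einf leeNl; apply: limf_esup_ge.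
by apply: filterS fl => a; rewrite leeN2.
Qed.

Lemma limf_einf_ge {T : choiceType} {X : filteredType T} {R : realType}
    (f : X -> \bar R) (F : set_system X) {FF : ProperFilter F} (l : \bar R) :
  (\forall a \near F, (l <= f a)%E) -> (l <= limf_einf f F)%E.
Proof.
move=> lf; rewrite /limf_einf leeNr; apply: limf_esup_le.
by apply: filterS lf => a; rewrite leeN2.
Qed.

(** * Real powers *)

Section RealPowers.
Context {R : realType}.

Lemma powRD_gt0 (a r s : R) : 0 < a -> a `^ (r + s) = a `^ r * a `^ s.
Proof. by move=> a0; apply: powRD; apply/implyP => _; rewrite gt_eqF. Qed.

Lemma powRVK (a r : R) : 0 < a -> 0 <= r -> (r `^ a^-1) `^ a = r.
Proof. by move=> a0 r0; rewrite -powRrM mulVf ?gt_eqF// powRr1. Qed.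

Lemma powRKV (a r : R) : 0 < a -> 0 <= r -> (r `^ a) `^ a^-1 = r.
Proof. by move=> a0 r0; rewrite -powRrM mulfV ?gt_eqF// powRr1. Qed.

End RealPowers.

(** * Box dimension from the growth of the area *)

Section Criterion.
Context {R : realType}.
Implicit Types (A : set (R * R)) (d s c C : R).

Lemma minkowski_ratio_ge0 A s e : (0 <= minkowski_ratio A s e)%E.
Proof.
by rewrite /minkowski_ratio mule_ge0 ?measure_ge0 ?lee_fin ?invr_ge0 ?powR_ge0.
Qed.

(** The ratio is at most C * e ^ (s - d), with a positive exponent. *)
Lemma upper_minkowski_eq0 A d s C : d < s ->
  (\forall e \near (0 : R)^'+,
    (area (eps_nbhd A e) <= (C * e `^ (2 - d))%:E)%E) ->
  upper_minkowski s A = 0%E.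
Proof.
move=> ds hC; apply/eqP; rewrite eq_le; apply/andP; split; last first.
  by apply: limf_esup_ge; near=> e; exact: minkowski_ratio_ge0.
apply/lee_addgt0Pr => eta eta0; rewrite add0e; apply: limf_esup_le.
have cv : (C * e `^ (s - d) @[e --> (0 : R)^'+] --> (0 : R)).
  rewrite -[X in _ --> X](mulr0 C); apply: cvgM; first exact: cvg_cst.
  by apply: powR_cvg0; rewrite subr_gt0.
have small : \forall e \near (0 : R)^'+, C * e `^ (s - d) < eta.
  exact: (cvgr_lt _ cv).
near=> e.
have e0 : 0 < e by near: e; exact: nbhs_right_gt.
rewrite /minkowski_ratio.
apply: (@le_trans _ _ ((C * e `^ (2 - d))%:E * ((e `^ (2 - s))^-1)%:E)%E).
  apply: lee_wpmul2r; first by rewrite lee_fin invr_ge0 powR_ge0.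
  by near: e.
rewrite -EFinM lee_fin -mulrA -powRN -powRD_gt0//.
have -> : 2 - d + - (2 - s) = s - d by lra.
by apply: ltW; near: e.
Unshelve. all: by end_near. Qed.

(** The ratio is at least c * e ^ (s - d) >= c, as e <= 1 and s - d <= 0. *)
Lemma lower_minkowski_gt0 A d s c : 0 < c -> s <= d ->
  (\forall e \near (0 : R)^'+,
    ((c * e `^ (2 - d))%:E <= area (eps_nbhd A e))%E) ->
  (0 < lower_minkowski s A)%E.
Proof.
move=> c0 sd hc; apply: (@lt_le_trans _ _ c%:E); first by rewrite lte_fin.
apply: limf_einf_ge; near=> e.
have e0 : 0 < e by near: e; exact: nbhs_right_gt.
have e1 : e <= 1 by near: e; exact: nbhs_right_le.
rewrite /minkowski_ratio.
apply: (@le_trans _ _ ((c * e `^ (2 - d))%:E * ((e `^ (2 - s))^-1)%:E)%E).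
  rewrite -EFinM lee_fin -mulrA -powRN -powRD_gt0//.
  have -> : 2 - d + - (2 - s) = s - d by lra.
  rewrite ler_peMr ?(ltW c0)// -[leLHS](powRr0 e); apply: ger_powR.
    by rewrite e0 e1.
  by lra.
apply: lee_wpmul2r; first by rewrite lee_fin invr_ge0 powR_ge0.
by near: e.
Unshelve. all: by end_near. Qed.

Lemma lower_minkowski_le_upper A s :
  (lower_minkowski s A <= upper_minkowski s A)%E.
Proof.
rewrite /upper_minkowski limf_esupE; apply: le_ereal_inf_tmp => _ [V FV <-].
apply: limf_einf_le; apply: filterS FV => a Va.
by apply: ereal_sup_ubound; exists a.
Qed.

Lemma ereal_inf_threshold (P : R -> Prop) d : 0 < d ->
  (forall s, d < s -> P s) -> (forall s, s <= d -> ~ P s) ->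
  ereal_inf [set s%:E | s in [set s : R | 0 < s /\ P s]] = d%:E.
Proof.
move=> d0 Pgt Ple; apply/eqP; rewrite eq_le; apply/andP; split.
  apply/lee_addgt0Pr => e e0; apply: ereal_inf_lbound.
  by exists (d + e) => //=; split; [|apply: Pgt]; lra.
apply: le_ereal_inf_tmp => _ [s [_ Ps] <-]; rewrite lee_fin.
by have [//|/ltW/Ple] := leP d s.
Qed.

(** The s-dimensional contents are positive up to d and vanish beyond it, so
    both infima defining the box dimensions equal d. *)
Lemma has_box_dim_area A d c C : 0 < d -> 0 < c ->
  (\forall e \near (0 : R)^'+,
    ((c * e `^ (2 - d))%:E <= area (eps_nbhd A e))%E) ->
  (\forall e \near (0 : R)^'+,
    (area (eps_nbhd A e) <= (C * e `^ (2 - d))%:E)%E) ->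
  has_box_dim A d.
Proof.
move=> d0 c0 hc hC; split; apply: ereal_inf_threshold => // s.
- move=> ds; apply/eqP; rewrite eq_le; apply/andP; split.
    by rewrite -(upper_minkowski_eq0 A d s C)// lower_minkowski_le_upper.
  by apply: limf_einf_ge; near=> e; exact: minkowski_ratio_ge0.
- by move=> sd s0; have := lower_minkowski_gt0 A d s c c0 sd hc; rewrite s0 ltxx.
- by move=> ds; exact: upper_minkowski_eq0 ds hC.
- move=> sd s0; have := lower_minkowski_gt0 A d s c c0 sd hc.
  by move/lt_le_trans => /(_ _ (lower_minkowski_le_upper A s)); rewrite s0 ltxx.
Unshelve. all: by end_near. Qed.

End Criterion.

(** * Area in the plane *)

Section Area.
Context {R : realType}.
Local Notation leb := (@lebesgue_measure R).

Lemma measurable_eps_nbhd_range (c : nat -> R * R) e :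
  measurable (eps_nbhd (range c) e).
Proof.
have -> : eps_nbhd (range c) e = \bigcup_k [set p | Defs.edist p (c k) < e].
  apply/seteqP; split => p.
    by move=> [_ [k _ <-] pk]; exists k.
  by move=> [k _ pk]; exists (c k) => //; exists k.
apply: bigcupT_measurable => k.
have -> : [set p | Defs.edist p (c k) < e] =
    setT `&` (fun p => Defs.edist p (c k)) @^-1` `]-oo, e[.
  by rewrite setTI; apply/seteqP; split => p /=; rewrite in_itv.
suff : measurable_fun setT (fun p => Defs.edist p (c k)) by exact.
apply: (@measurableT_comp _ _ _ _ _ _ (@Num.sqrt R)).
  exact: (continuous_measurable_fun (@sqrt_continuous R)).
by apply: measurable_funD; apply: measurable_funX; apply: measurable_funB.
Qed.

(** Area is an iterated integral in a fixed order; uniqueness of the product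
    measure allows the other order, which reflects the set. *)
Lemma area_swap (A : set (R * R)) : measurable A ->
  area A = area [set p | A (p.2, p.1)].
Proof.
move=> mA; transitivity ((leb \x^ leb)%E A).
  apply: (@product_measure_unique _ _ _ _ _ leb leb (leb \x^ leb)%E)
    => // B C mB mC.
  by rewrite /= product_measure2E.
(* Sections of A at height v are sections of the reflected set at abscissa v,
   so the two iterated integrals are convertible. *)
by [].
Qed.

Lemma area_rect (a b l r : R) : 0 <= l -> 0 <= r ->
  area (`[a, a + l[ `*` `[b, b + r[) = (l * r)%:E.
Proof.
move=> l0 r0; rewrite /area product_measure1E//= !lebesgue_measure_itv /=.
rewrite !lte_fin EFinM; congr (_ * _)%E; case: ltP; rewrite -?EFinD => h; congr EFin; lra.
Qed.

Lemma area_cover (A : set (R * R)) (c : nat -> R * R) (n : nat) (r : R) :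
  measurable A -> 0 <= r ->
  (forall p, A p -> exists2 j, (j < n)%N &
    (`|p.1 - (c j).1| < r) && (`|p.2 - (c j).2| < r)) ->
  (area A <= (n%:R * (2 * r) ^+ 2)%:E)%E.
Proof.
move=> mA r0 cov.
pose Q j : set (R * R) :=
  `[(c j).1 - r, (c j).1 - r + 2 * r[ `*` `[(c j).2 - r, (c j).2 - r + 2 * r[.
apply: (@le_trans _ _ (\sum_(k < n) area (Q k))%E).
  apply: (@content_subadditive _ _ _ (leb \x leb)%E) => //.
    by move=> k _; apply: measurableX.
  move=> p /cov[j jn /andP[h1 h2]]; rewrite -bigcup_mkord; exists j => //=.
  by move: h1 h2; rewrite /Q /= !in_itv /= !ltr_distl => /andP[? ?] /andP[? ?];
    split; lra.
rewrite (eq_bigr (fun=> ((2 * r) ^+ 2)%:E)); last first.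
  by move=> k _; rewrite area_rect ?expr2//; lra.
by rewrite sumEFin lee_fin sumr_const card_ord [leRHS]mulr_natl.
Qed.

(** Cavalieri: integrate the lower bound l on the sections over ]0, b[. *)
Lemma area_ge_sections (A : set (R * R)) (b l : R) : measurable A ->
  0 <= b -> 0 <= l ->
  (forall u, 0 < u < b -> exists v, `[v, v + l[ `<=` xsection A u) ->
  ((b * l)%:E <= area A)%E.
Proof.
move=> mA b0 l0 sec.
have mf := measurable_fun_xsection (@lebesgue_measure R) mA.
have sub : (\int[@lebesgue_measure R]_(u in `]0%R, b[)
    (lebesgue_measure \o xsection A) u <= area A)%E.
  rewrite /area /product_measure1.
  by apply: ge0_subset_integral => //= u _; exact: measure_ge0.
apply: le_trans sub.
have <- : (\int[@lebesgue_measure R]_(u in `]0%R, b[) l%:E = (b * l)%:E)%E.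
  rewrite integral_cst//= lebesgue_measure_itv /= lte_fin EFinM muleC.
  by case: ltP => [_|b0']; [rewrite -EFinD subr0|
    have -> : b = 0 by apply/eqP; rewrite eq_le b0'].
apply: ge0_le_integral => //=.
  exact: measurable_funTS.
move=> u; rewrite in_itv /= => /sec[v vA].
apply: (@le_trans _ _ (lebesgue_measure `[v, v + l[)).
  rewrite lebesgue_measure_itv /= lte_fin.
  case: ltP => [_|]; rewrite ?lee_fin; last lra.
  lra.
apply: le_measure => //; rewrite inE//.
exact: measurable_xsection.
Qed.

End Area.

(** * Decay rate of a sequence with power-law steps *)

Section Decay.
Context {R : realType}.

(** Bernoulli's inequality for a negative exponent, from 1 + t <= expR t and
    ln (1 - h) <= - h. *)
Lemma powR_bernoulli (q h : R) : 0 <= q -> 0 <= h < 1 ->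
  1 + q * h <= (1 - h) `^ (- q).
Proof.
move=> q0 /andP[h0 h1]; rewrite /powR subr_eq0 gt_eqF//.
apply: le_trans (expR_ge1Dx _); rewrite lerD2l mulNr -mulrN ler_wpM2l// lerNr.
by apply: le_ln1Dx; lra.
Qed.

(** One step of the recursion in the variable a ^ (- q): since b = a * (1 - h)
    with h >= c * a ^ q, Bernoulli gives
    b ^ (- q) >= a ^ (- q) * (1 + q * h) >= a ^ (- q) + q * c. *)
Lemma powRN_growth (q a b c : R) : 0 < q -> 0 < b -> b <= a ->
  c * a `^ (q + 1) <= a - b -> a `^ (- q) + q * c <= b `^ (- q).
Proof.
move=> q0 b0 ba hc; have a0 := lt_le_trans b0 ba.
pose h := (a - b) / a.
have bE : b = a * (1 - h) by rewrite /h; field; rewrite gt_eqF.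
have h01 : 0 <= h < 1.
  by rewrite /h divr_ge0 ?subr_ge0 ?(ltW a0)// ltr_pdivrMr//; lra.
have hge : c * a `^ q <= h.
  rewrite /h ler_pdivlMr// -mulrA; move: hc.
  by rewrite powRD_gt0// powRr1 ?(ltW a0).
rewrite bE powRM; [|lra|lra].
apply: (@le_trans _ _ (a `^ (- q) * (1 + q * h))); last first.
  by rewrite ler_wpM2l ?powR_ge0// powR_bernoulli// ltW.
rewrite mulrDr mulr1 lerD2l mulrCA ler_wpM2l ?(ltW q0)//.
apply: le_trans (_ : a `^ (- q) * (c * a `^ q) <= _); last first.
  by rewrite ler_wpM2l ?powR_ge0.
by rewrite mulrCA powRN mulVf ?mulr1// gt_eqF// powR_gt0.
Qed.

(** Summing [powRN_growth] with q = alpha - 1 makes x k ^ (- q) grow at least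
    linearly; inverting the power gives the decay rate. *)
Lemma step_decay (x : nat -> R) (alpha c : R) : 1 < alpha -> 0 < c ->
  (forall k, 0 < x k) -> decreasing_seq x ->
  (\forall k \near \oo, c <= (x k - x k.+1) / x k `^ alpha) ->
  exists2 C, 0 < C &
    \forall k \near \oo, x k <= C * k%:R `^ (- (alpha - 1)^-1).
Proof.
move=> a1 c0 x0 xdecr [N _ hN]; pose q := alpha - 1.
have q0 : 0 < q by rewrite subr_gt0.
have qc0 : 0 < q * c by rewrite mulr_gt0.
have grow k : x (N + k)%N `^ (- q) >= k%:R * (q * c).
  elim: k => [|k IH]; first by rewrite mul0r powR_ge0.
  rewrite addnS; apply: le_trans (powRN_growth q (x (N + k)%N) _ c _ _ _ _) => //.
  - by rewrite -natr1 mulrDl mul1r lerD2r.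
  - by apply/ltW; move/decreasing_seqP: xdecr; apply.
  - have := hN (N + k)%N (leq_addr _ _).
    by rewrite ler_pdivlMr ?powR_gt0// subrK.
(* Halving the slope absorbs the first N indices once k >= 2 N. *)
pose D := q * c / 2.
have D0 : 0 < D by rewrite divr_gt0.
rewrite -/q; exists (D `^ (- q^-1)); first exact: powR_gt0.
near=> k.
have k0 : (0 < k)%N by near: k; exact: nbhs_infty_ge.
have kN : (N.*2 <= k)%N by near: k; exact: nbhs_infty_ge.
have kr0 : 0 < k%:R :> R by rewrite ltr0n.
have low : D * k%:R <= x k `^ (- q).
  have := grow (k - N)%N; rewrite subnKC; last by lia.
  apply: le_trans; rewrite natrB; last by lia.
  have : (N.*2)%:R <= k%:R :> R by rewrite ler_nat ?kN.
  by rewrite -muln2 natrM => h; rewrite /D; nra.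
rewrite -powRM ?(ltW D0) ?(ltW kr0)//.
have -> : x k = (x k `^ (- q)) `^ (- q^-1).
  by rewrite -powRrM mulrNN mulfV ?gt_eqF// powRr1// ltW.
rewrite !(powRN _ q^-1) lef_pV2 ?posrE ?powR_gt0 ?mulr_gt0//.
have Dk0 : 0 <= D * k%:R by rewrite mulr_ge0 ?(ltW D0) ?(ltW kr0).
by apply: ge0_ler_powR; rewrite ?nnegrE ?invr_ge0 ?powR_ge0 ?(ltW q0) ?Dk0.
Unshelve. all: by end_near. Qed.

Lemma decay_slower (x : nat -> R) (p r : R) : p <= r ->
  (exists2 C, 0 < C & \forall k \near \oo, x k <= C * k%:R `^ (- r)) ->
  exists2 C, 0 < C & \forall k \near \oo, x k <= C * k%:R `^ (- p).
Proof.
move=> pr [C C0 hC]; exists C => //; near=> k.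
have k1 : (1 <= k)%N by near: k; exact: nbhs_infty_ge.
apply: (@le_trans _ _ (C * k%:R `^ (- r))); first by near: k.
by rewrite ler_pM2l// ler_powR ?ler1n// lerN2.
Unshelve. all: by end_near. Qed.

End Decay.

(** * Upper bound for the area of the neighbourhood *)

Section EuclideanDistance.
Context {R : realType}.
Implicit Types p q : R * R.

Lemma edist_ge_fst p q : `|p.1 - q.1| <= Defs.edist p q.
Proof. by rewrite /Defs.edist -sqrtr_sqr ler_wsqrtr// lerDl sqr_ge0. Qed.

Lemma edist_ge_snd p q : `|p.2 - q.2| <= Defs.edist p q.
Proof. by rewrite /Defs.edist -sqrtr_sqr ler_wsqrtr// lerDr sqr_ge0. Qed.

Lemma edist_le p q : Defs.edist p q <= `|p.1 - q.1| + `|p.2 - q.2|.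
Proof.
rewrite /Defs.edist -[leRHS]ger0_norm ?addr_ge0// -[leRHS]sqrtr_sqr ler_wsqrtr//.
by rewrite [leRHS]sqrrD !real_normK ?num_real// lerD2r lerDl mulrn_wge0// mulr_ge0.
Qed.

End EuclideanDistance.

Section UpperBound.
Context {R : realType}.
Implicit Types x y : nat -> R.

(** Along a monotone chain both coordinates move in the same direction, so the
    gap of x + y is the sum of the gaps of x and y. *)
Lemma chain_gap_lt x y (e : R) k l :
  {homo x : i j / (i <= j)%N >-> j <= i} ->
  {homo y : i j / (i <= j)%N >-> j <= i} ->
  `|(x k + y k) - (x l + y l)| < e -> `|x k - x l| < e /\ `|y k - y l| < e.
Proof.
move=> xd yd; rewrite !ltr_norml.
by case: (leqP k l) => [|/ltnW] kl; move: (xd _ _ kl) (yd _ _ kl)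
  => ? ? /andP[? ?]; split; lra.
Qed.

(** The first n points are their own centres.  The others are sorted into cells
    by the integer part of (x k + y k) / e, which takes at most
    trunc (T / e) + 1 values, and each nonempty cell gets one of its points as
    centre. *)
Lemma chain_cover x y (T e : R) (n : nat) : 0 < e ->
  {homo x : i j / (i <= j)%N >-> j <= i} ->
  {homo y : i j / (i <= j)%N >-> j <= i} ->
  (forall k, (n <= k)%N -> 0 <= x k + y k <= T) ->
  exists centre : nat -> nat, forall k,
    exists2 j, (j < n + (Num.trunc (T / e)).+1)%N &
      `|x k - x (centre j)| < e /\ `|y k - y (centre j)| < e.
Proof.
move=> e0 xd yd bound.
(* The centre numbered n + i is a point of the i-th cell; the default 0 is
   taken for empty cells, which contain no point to be covered. *)
pose cell k := Num.trunc ((x k + y k) / e).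
pose rep i := xget 0%N [set k | (n <= k)%N /\ cell k = i].
exists (fun j => if (j < n)%N then j else rep (j - n)%N) => k.
have [kn|nk] := ltnP k n.
  by exists k; rewrite ?kn ?subrr ?normr0//; apply: leq_trans kn (leq_addr _ _).
exists (n + cell k)%N.
  rewrite ltn_add2l ltnS; have /andP[? ?] := bound _ nk.
  by apply: Num.Theory.le_truncn; rewrite ler_pM2r ?invr_gt0.
rewrite ltnNge leq_addr /= addKn; apply: chain_gap_lt => //.
have : [set k' | (n <= k')%N /\ cell k' = cell k] (rep (cell k)).
  by apply: (@xgetPex _ _ [set k' | (n <= k')%N /\ cell k' = cell k]); exists k.
set l := rep _ => -[nl cl].
have itv i : (n <= i)%N ->
    (cell i)%:R * e <= x i + y i < ((cell i)%:R + 1) * e.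
  move=> /bound/andP[t0 _].
  have := truncn_itv (divr_ge0 t0 (ltW e0)).
  by rewrite ler_pdivlMr// ltr_pdivrMr// natr1.
have := itv _ nk; have := itv _ nl.
rewrite cl mulrDl mul1r => /andP[? ?] /andP[? ?].
by rewrite ltr_norml; apply/andP; split; lra.
Qed.

(** A point of the e-neighbourhood is within 2 * e of a centre of
    [chain_cover] in each coordinate: squares of side 4 * e suffice. *)
Lemma area_orbit_le x y (T e : R) (n : nat) : 0 < e ->
  {homo x : i j / (i <= j)%N >-> j <= i} ->
  {homo y : i j / (i <= j)%N >-> j <= i} ->
  (forall k, (n <= k)%N -> 0 <= x k + y k <= T) ->
  (area (eps_nbhd (orbit2 x y) e) <= ((n%:R + T / e + 1) * (16 * e ^+ 2))%:E)%E.
Proof.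
move=> e0 xd yd bound.
have [centre centreP] := chain_cover x y T e n e0 xd yd bound.
have T0 : 0 <= T by have /andP[/le_trans] := bound _ (leqnn n); apply.
pose m := (n + (Num.trunc (T / e)).+1)%N.
apply: (@le_trans _ _ (m%:R * (2 * (2 * e)) ^+ 2)%:E).
  apply: (area_cover _ (fun j => (x (centre j), y (centre j)))) => //.
  - exact: measurable_eps_nbhd_range.
  - by rewrite mulr_ge0 ?(ltW e0).
  move=> p [_ [k _ <-] pk]; have [j jn [hx hy]] := centreP k; exists j => //=.
  have := le_lt_trans (edist_ge_fst _ _) pk.
  have := le_lt_trans (edist_ge_snd _ _) pk.
  move: hx hy; rewrite /= !ltr_distl.
  move=> /andP[? ?] /andP[? ?] /andP[? ?] /andP[? ?].
  by apply/andP; split; apply/andP; split; lra.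
have -> : (2 * (2 * e)) ^+ 2 = 16 * e ^+ 2 by ring.
rewrite lee_fin ler_wpM2r ?(mulr_ge0 _ (sqr_ge0 _))//.
rewrite natrD -natr1 addrA lerD2r lerD2l.
by have /andP[] := truncn_itv (divr_ge0 T0 (ltW e0)).
Qed.

(** The cut n ~ e ^ (- d) balances the two parts of the cover: the tail then has
    size T ~ n ^ (- p) ~ e ^ (d * p) = e ^ (1 - d), so that T / e is also of
    order e ^ (- d). *)
Lemma area_orbit_decay x y (p d C : R) :
  0 < d -> 0 < p -> d * p = 1 - d -> 0 < C ->
  (forall k, 0 < x k) -> (forall k, 0 < y k) ->
  {homo x : i j / (i <= j)%N >-> j <= i} ->
  {homo y : i j / (i <= j)%N >-> j <= i} ->
  (\forall k \near \oo, x k <= C * k%:R `^ (- p)) ->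
  (\forall k \near \oo, y k <= C * k%:R `^ (- p)) ->
  \forall e \near (0 : R)^'+, (area (eps_nbhd (orbit2 x y) e) <=
    ((48 + 32 * C) * e `^ (2 - d))%:E)%E.
Proof.
move=> d0 p0 dp C0 x0 y0 xd yd [N1 _ h1] [N2 _ h2]; near=> e.
have e0 : 0 < e by near: e; exact: nbhs_right_gt.
have e1 : e <= 1 by near: e; exact: nbhs_right_le.
pose n := (Num.trunc (e `^ (- d))).+1.
have m0 : 0 < e `^ (- d) by exact: powR_gt0.
have [nlow nup] : e `^ (- d) <= n%:R /\ n%:R <= e `^ (- d) + 1.
  have /andP[? /ltW ?] := truncn_itv (ltW m0).
  by split => //; rewrite /n -natr1 lerD2r.
have n0 : 0 < n%:R :> R by exact: lt_le_trans nlow.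
have m1 : 1 <= e `^ (- d).
  by rewrite -[leLHS](powRr0 e) ger_powR ?e0 ?e1//; lra.
have nN : (maxn N1 N2 <= n)%N.
  rewrite -(ler_nat R); apply: le_trans nlow.
  apply: (@le_trans _ _ (maxn N1 N2).+1%:R); first by rewrite ler_nat.
  rewrite powRN -[leLHS]invrK lef_pV2 ?posrE ?invr_gt0 ?powR_gt0//.
  rewrite -[leRHS](powRVK d)// ?invr_ge0//.
  apply: ge0_ler_powR; rewrite ?nnegrE ?powR_ge0 ?(ltW d0) ?(ltW e0)//.
  by near: e; apply: nbhs_right_le; rewrite powR_gt0 ?invr_gt0 ?ltr0n.
have tail k : (n <= k)%N -> 0 <= x k + y k <= 2 * C * e `^ (1 - d).
  move=> nk; have k0 : 0 < k%:R :> R.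
    by apply: lt_le_trans n0 _; rewrite ler_nat.
  have kp : k%:R `^ (- p) <= e `^ (1 - d).
    rewrite -dp -[e `^ _]invrK -powRN -mulNr powRrM powRN.
    rewrite lef_pV2 ?posrE ?powR_gt0//.
    apply: ge0_ler_powR; rewrite ?nnegrE ?(ltW p0) ?(ltW m0) ?(ltW k0)//.
    by apply: le_trans nlow _; rewrite ler_nat.
  have Ck : C * k%:R `^ (- p) <= C * e `^ (1 - d) by rewrite ler_pM2l.
  have := h1 k; have := h2 k => /= h2k h1k.
  have {}h1k : x k <= C * k%:R `^ (- p).
    by apply/h1k/(leq_trans (leq_maxl _ _) (leq_trans nN nk)).
  have {}h2k : y k <= C * k%:R `^ (- p).
    by apply/h2k/(leq_trans (leq_maxr _ _) (leq_trans nN nk)).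
  have := x0 k; have := y0 k => ? ?.
  by apply/andP; split; lra.
apply: le_trans (area_orbit_le x y _ e n e0 xd yd tail) _.
have eE : e `^ (1 - d) / e = e `^ (- d).
  by rewrite addrC powRD_gt0// powRr1 ?(ltW e0)// mulfK ?gt_eqF.
have -> : e `^ (2 - d) = e `^ (- d) * e ^+ 2.
  by rewrite addrC powRD_gt0// powR_mulrn ?(ltW e0).
have count : n%:R + 2 * C * e `^ (1 - d) / e + 1 <= (3 + 2 * C) * e `^ (- d).
  by rewrite -mulrA eE; lra.
rewrite lee_fin; have -> : (48 + 32 * C) * (e `^ (- d) * e ^+ 2) =
    (3 + 2 * C) * e `^ (- d) * (16 * e ^+ 2) by ring.
by rewrite ler_wpM2r// mulr_ge0// sqr_ge0.
Unshelve. all: by end_near. Qed.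

End UpperBound.

(** * Lower bound for the area of the neighbourhood *)

Section LowerBound.
Context {R : realType}.
Implicit Types x y : nat -> R.

Lemma exists_gap x (n : nat) (u : R) : x @ \oo --> (0 : R) ->
  0 < u -> u < x n -> exists2 k, (n <= k)%N & x k.+1 <= u < x k.
Proof.
move=> xc u0 un.
have ex : exists j, x (n + j)%N <= u.
  have : \forall k \near \oo, x k < u by exact: (cvgr_lt _ xc).
  move=> [N _ hN]; exists N; apply/ltW/hN => /=; exact: leq_addl.
case: (ex_minnP ex) => -[|j]; first by rewrite addn0 leNgt un.
rewrite addnS => xj minj; exists (n + j)%N; first exact: leq_addr.
by rewrite xj /= ltNge; apply/negP => /minj; rewrite ltnn.
Qed.

(** Every u in ]0, x n[ lies in a gap [x k.+1, x k] of length at most e / 2 with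
    n <= k, so the points (u, v) with y k <= v < y k + e / 2 are at
    distance less than e from (x k, y k). *)
Lemma area_orbit_ge x y (e : R) (n : nat) : 0 < e -> 0 < x n ->
  x @ \oo --> (0 : R) ->
  (forall k, (n <= k)%N -> x k - x k.+1 <= e / 2) ->
  ((x n * (e / 2))%:E <= area (eps_nbhd (orbit2 x y) e))%E.
Proof.
move=> e0 xn xc gap; apply: area_ge_sections.
- exact: measurable_eps_nbhd_range.
- exact: ltW.
- by rewrite divr_ge0 ?(ltW e0).
move=> u /andP[u0 un]; have [k nk /andP[k1 k2]] := exists_gap x n u xc u0 un.
exists (y k) => v /=; rewrite in_itv /= => /andP[v1 v2].
apply/xsectionP; exists (x k, y k); first by exists k.
apply: le_lt_trans (edist_le _ _) _ => /=.
have := gap k nk; rewrite ltr0_norm ?subr_lt0// ger0_norm ?subr_ge0//; lra.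
Qed.

(** The relative gap (x k - x k.+1) / x k is at most c * x k ^ (a - 1), which
    tends to 0.  This keeps x from jumping far below a given threshold. *)
Lemma step_half x (a c : R) : 1 < a -> (forall k, 0 < x k) ->
  x @ \oo --> (0 : R) -> 0 < c ->
  (\forall k \near \oo, x k - x k.+1 <= c * x k `^ a) ->
  \forall k \near \oo, x k / 2 <= x k.+1.
Proof.
move=> a1 x0 xc c0 step.
(* Below rho one has c * x k ^ (a - 1) <= 1 / 2. *)
pose rho := (2 * c)^-1 `^ (a - 1)^-1.
have rho0 : 0 < rho by rewrite powR_gt0 ?invr_gt0 ?mulr_gt0.
have small : \forall k \near \oo, x k < rho by exact: (cvgr_lt _ xc).
near=> k.
have step_k : x k - x k.+1 <= c * x k `^ a by near: k.
have xk : x k <= rho by apply: ltW; near: k.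
have : x k `^ (a - 1) <= (2 * c)^-1.
  have q0 : 0 < a - 1 by lra.
  rewrite -[leRHS](powRVK (a - 1))// ?invr_ge0 ?mulr_ge0 ?(ltW c0)//.
  by apply: ge0_ler_powR; rewrite ?nnegrE ?subr_ge0 ?(ltW a1)//;
    apply: ltW.
rewrite -(ler_pM2r (x0 k)) mulrC mulr_powRB1 ?(ltW (x0 k))//; last lra.
rewrite -(ler_pM2l c0).
have -> : c * ((2 * c)^-1 * x k) = x k / 2 by field; rewrite gt_eqF.
lra.
Unshelve. all: by end_near. Qed.

(** [area_orbit_ge] applied from the first term at most delta ~ e ^ (1 / a);
    by [step_half] that term is at least delta / 2. *)
Lemma area_orbit_step x y (a c : R) : 1 < a -> (forall k, 0 < x k) ->
  {homo x : i j / (i <= j)%N >-> j <= i} ->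
  x @ \oo --> (0 : R) -> 0 < c ->
  (\forall k \near \oo, x k - x k.+1 <= c * x k `^ a) ->
  \forall e \near (0 : R)^'+,
    (((2 * c)^-1 `^ a^-1 / 4 * e `^ (1 + a^-1))%:E <=
      area (eps_nbhd (orbit2 x y) e))%E.
Proof.
move=> a1 x0 xd xc c0 step.
have [K _ hK] := filterI step (step_half x a c a1 x0 xc c0 step).
have a0 : 0 < a by lra.
near=> e.
have e0 : 0 < e by near: e; exact: nbhs_right_gt.
(* The threshold with c * delta ^ a = e / 2: gaps starting below delta are at
   most e / 2. *)
pose delta := ((2 * c)^-1 * e) `^ a^-1.
have c2 : 0 < (2 * c)^-1 by rewrite invr_gt0 mulr_gt0.
have delta0 : 0 < delta by rewrite powR_gt0// mulr_gt0.
have deltaK : delta < x K.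
  rewrite -[ltRHS](powRKV a)// ?(ltW (x0 K))//.
  rewrite gt0_ltr_powR ?nnegrE ?invr_gt0 ?powR_ge0//.
    by rewrite mulr_ge0 ?(ltW e0) ?(ltW c2).
  rewrite mulrC ltr_pdivrMr ?mulr_gt0//.
  by near: e; apply: nbhs_right_lt; rewrite mulr_gt0 ?mulr_gt0 ?powR_gt0.
have [k Kk /andP[k1 k2]] := exists_gap x K delta xc delta0 deltaK.
apply: le_trans (area_orbit_ge x y e k.+1 e0 (x0 _) xc _); last first.
  move=> j kj; have [step_j _] := hK j (leq_trans Kk (ltnW kj)).
  apply: le_trans step_j _.
  have xj : x j <= delta by apply: le_trans k1; exact: xd.
  apply: (@le_trans _ _ (c * delta `^ a)).
    rewrite ler_pM2l// ge0_ler_powR ?nnegrE ?(ltW a0)//; exact: ltW.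
  rewrite powRVK// ?mulr_ge0 ?(ltW c2) ?(ltW e0)//.
  by have -> : c * ((2 * c)^-1 * e) = e / 2 by field; rewrite gt_eqF.
have [_ /= half] := hK k Kk.
rewrite lee_fin powRD_gt0// powRr1 ?(ltW e0)//.
have dE : delta = (2 * c)^-1 `^ a^-1 * e `^ a^-1.
  by rewrite /delta powRM ?(ltW c2) ?(ltW e0).
have -> : (2 * c)^-1 `^ a^-1 / 4 * (e * e `^ a^-1) = (delta / 2) * (e / 2).
  by rewrite dE; field.
by rewrite ler_pM2r ?divr_gt0//; lra.
Unshelve. all: by end_near. Qed.

End LowerBound.

(** * Dimension of the orbit *)

Section OrbitDimension.
Context {R : realType}.
Implicit Types x y : nat -> R.

Lemma area_orbit_swap x y (e : R) :
  area (eps_nbhd (orbit2 x y) e) = area (eps_nbhd (orbit2 y x) e).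
Proof.
rewrite area_swap; last exact: measurable_eps_nbhd_range.
congr area; apply/seteqP; split => p [_ [k _ <-]] pk.
  exists (y k, x k); first by exists k.
  by move: pk; rewrite /Defs.edist /= addrC.
exists (x k, y k); first by exists k.
by move: pk; rewrite /Defs.edist /= addrC.
Qed.

Lemma has_box_dim_orbit_swap x y (d : R) :
  has_box_dim (orbit2 x y) d -> has_box_dim (orbit2 y x) d.
Proof.
suff E : minkowski_ratio (orbit2 y x) = minkowski_ratio (orbit2 x y).
  rewrite /has_box_dim /lower_box_dim /upper_box_dim.
  rewrite /lower_minkowski /upper_minkowski.
  by rewrite E.
apply/funext => s; apply/funext => e.
by rewrite /minkowski_ratio area_orbit_swap.
Qed.

(** The case where x decays no faster than y.  The decay exponents compare as
    1 / (alpha - 1) <= 1 / (beta - 1), so both coordinates decay at the rate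
    of x. *)
Lemma has_box_dim_orbit x y (alpha beta : R) :
  1 < beta -> beta <= alpha ->
  (forall k, 0 < x k) -> (forall k, 0 < y k) ->
  decreasing_seq x -> decreasing_seq y -> x @ \oo --> (0 : R) ->
  asymp_equiv (fun k => x k - x k.+1) (fun k => x k `^ alpha) ->
  asymp_equiv (fun k => y k - y k.+1) (fun k => y k `^ beta) ->
  has_box_dim (orbit2 x y) (1 - alpha^-1).
Proof.
move=> b1 ba x0 y0 xdecr ydecr xc.
move=> [c1 [c2 [c10 c20 xstep]]] [c3 [c4 [c30 c40 ystep]]].
have a1 : 1 < alpha by exact: lt_le_trans ba.
have a0 : 0 < alpha by lra.
have ia1 : alpha^-1 < 1 by rewrite invf_lt1.
have xd : {homo x : i j / (i <= j)%N >-> j <= i} by move=> i j; rewrite xdecr.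
have yd : {homo y : i j / (i <= j)%N >-> j <= i} by move=> i j; rewrite ydecr.
pose p := (alpha - 1)^-1.
have p0 : 0 < p by rewrite invr_gt0 subr_gt0.
have pb : p <= (beta - 1)^-1 by rewrite lef_pV2 ?posrE; lra.
have [C1 C10 xC] : exists2 C, 0 < C &
    \forall k \near \oo, x k <= C * k%:R `^ (- p).
  apply: (step_decay x alpha c1) => //.
  by apply: filterS xstep => k /andP[].
have [C2 C20 yC] : exists2 C, 0 < C &
    \forall k \near \oo, y k <= C * k%:R `^ (- p).
  apply: decay_slower pb _; apply: (step_decay y beta c3) => //.
  by apply: filterS ystep => k /andP[].
pose C := C1 + C2.
have xC' : \forall k \near \oo, x k <= C * k%:R `^ (- p).
  apply: filterS xC => k /le_trans; apply.
  by rewrite ler_wpM2r ?powR_ge0// lerDl ltW.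
have yC' : \forall k \near \oo, y k <= C * k%:R `^ (- p).
  apply: filterS yC => k /le_trans; apply.
  by rewrite ler_wpM2r ?powR_ge0// lerDr ltW.
have xgap : \forall k \near \oo, x k - x k.+1 <= c2 * x k `^ alpha.
  apply: filterS xstep => k /andP[_].
  by rewrite ler_pdivrMr// powR_gt0.
apply: (has_box_dim_area _ _ ((2 * c2)^-1 `^ alpha^-1 / 4) (48 + 32 * C)).
- by rewrite subr_gt0.
- by rewrite divr_gt0// powR_gt0// invr_gt0 mulr_gt0.
- have -> : 2 - (1 - alpha^-1) = 1 + alpha^-1 by lra.
  exact: area_orbit_step.
- apply: (area_orbit_decay x y p) => //.
  + by rewrite subr_gt0.
  + by rewrite /p; field; rewrite gt_eqF//= subr_eq0 gt_eqF.
  + by rewrite addr_gt0.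
Qed.

End OrbitDimension.

Theorem lemma2 (R : realType) (x y : nat -> R) (alpha beta : R)
    (x_gt0 : forall k, 0 < x k) (y_gt0 : forall k, 0 < y k)
    (x_decr : decreasing_seq x) (y_decr : decreasing_seq y)
    (x_cvg0 : x @ \oo --> (0 : R)) (y_cvg0 : y @ \oo --> (0 : R))
    (alpha_gt1 : 1 < alpha) (beta_gt1 : 1 < beta)
    (x_step : asymp_equiv (fun k => x k - x k.+1) (fun k => x k `^ alpha))
    (y_step : asymp_equiv (fun k => y k - y k.+1) (fun k => y k `^ beta)) :
  (beta <= alpha -> has_box_dim (orbit2 x y) (1 - alpha^-1)) /\
  (alpha < beta -> has_box_dim (orbit2 x y) (1 - beta^-1)).
Proof.
split=> [ba|/ltW ab]; first exact: (has_box_dim_orbit x y alpha beta).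
by apply: has_box_dim_orbit_swap; exact: (has_box_dim_orbit y x beta alpha).
Qed.
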